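(* Let $n \geq 1$ be an integer. The trigonometric approximation $\mathcal{TA}$ (a set of real symmetric $n \times n$ matrices) is star-like: for every $X \in \mathcal{TA}$ and every $\lambda \in [0,1]$, the convex combination $\lambda X + (1-\lambda) I$ belongs to $\mathcal{TA}$, where $I$ is the $n \times n$ identity matrix.
   Context: For a real symmetric $n \times n$ matrix $X$, $X \succeq 0$ means that $X$ is positive semidefinite, and $\operatorname{diag} X = 1$ means that all diagonal entries of $X$ equal $1$. Define $$\mathcal{SR} = \{ X \text{ real symmetric } n \times n \mid X \succeq 0,\ \operatorname{diag} X = 1 \}.$$ All entries of a matrix in $\mathcal{SR}$ lie in $[-1,1]$. Let $f : [-1,1] \to [-1,1]$ be $f(x) = \frac{2}{\pi} \arcsin x$, and let $\mathbf{f}$ be the operator applying $f$ element-wise to a matrix with entries in $[-1,1]$, i.e. $(\mathbf{f}(X))_{ij} = f(X_{ij})$. The trigonometric approximation (of the Max-Cut polytope) is $$\mathcal{TA} = \{ \mathbf{f}(X) \mid X \in \mathcal{SR} \}.$$ *)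

(* Defs.v *)
From HB Require Import structures.
From mathcomp Require Import all_boot all_order all_algebra.
From mathcomp Require Import all_classical all_reals all_analysis.

Set Implicit Arguments.
Unset Strict Implicit.
Unset Printing Implicit Defensive.

Import Order.TTheory GRing.Theory Num.Theory.

Local Open Scope ring_scope.
Local Open Scope classical_set_scope.

Definition psdmx (R : realType) (n : nat) (X : 'M[R]_n) : Prop :=
  X \is symmetricmx /\ forall v : 'cV[R]_n, 0 <= (v^T *m X *m v) 0 0.

Definition SR (R : realType) (n : nat) : set 'M[R]_n :=
  [set X | psdmx X /\ forall i, X i i = 1].

(* [asin] is a total function; only its values on [-1, 1] matter here, since
   the entries of a matrix in [SR] lie in that interval. *)
Definition trig_f (R : realType) (x : R) : R := 2 / pi * asin x.

Definition TA (R : realType) (n : nat) : set 'M[R]_n :=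
  [set map_mx (@trig_f R) X | X in @SR R n].

(* Main.v *)
Require Import Defs.
From mathcomp Require Import all_boot all_order all_algebra.
From mathcomp Require Import all_classical all_reals all_analysis.
From mathcomp Require Import ring lra zify.

Import Order.TTheory GRing.Theory Num.Theory.
Import numFieldNormedType.Exports.

Local Open Scope ring_scope.
Local Open Scope classical_set_scope.

Set Implicit Arguments.
Unset Strict Implicit.
Unset Printing Implicit Defensive.

(** A point of the trigonometric approximation is [2/pi * asin A] entrywise, for
    a correlation matrix [A].  Off the diagonal, moving it towards the identity
    by the factor [lambda] amounts to replacing [A i j] by
    [sin (lambda * asin (A i j))], so the task is to show that this
    replacement, completed by ones on the diagonal, is positive semidefinite.

    The reason is that, for [0 <= lambda <= 1], the function
    [g x = sin (lambda * asin x)] has a power series with nonnegative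
    coefficients: it solves [(1 - x^2) g'' - x g' + lambda^2 g = 0] with
    [g 0 = 0] and [g' 0 = lambda], hence its coefficients satisfy
    [(k+1)(k+2) a_(k+2) = (k^2 - lambda^2) a_k] with [a_0 = 0] and
    [a_1 = lambda], and the only negative factor, at [k = 0], multiplies
    [a_0 = 0].  By the Schur product theorem ([schur_product]) the entrywise
    powers of a positive semidefinite matrix are positive semidefinite, and so
    are their nonnegative combinations and limits ([psdmx_map_pseries]).

    The series is available for [`|x| < 1] only, whereas entries of a
    correlation matrix can be [1] or [-1]; the matrix is therefore first scaled
    by [r < 1], and [r] tends to [1] ([psdmx_map_sin_mul_asin]).  The diagonal
    entries of [g A] are [sin (lambda * pi / 2) <= 1]; adding the nonnegative
    multiple of the identity that brings them to [1] concludes.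

    That the series sums to [g] ([sin_mul_asinE]) is obtained by substituting
    [x = sin t]: the differential equation becomes [h'' = - lambda^2 h], for which
    [sin (lambda * t)] is the solution with the same initial data. *)

(** * Positive semidefinite matrices *)

Section Psd.
Variables (R : realType) (n : nat).
Implicit Types (A B : 'M[R]_n) (v w : 'I_n -> R).

Definition qform A v : R := \sum_i \sum_j v i * A i j * v j.

Lemma psdmxP A :
  psdmx A <-> (forall i j, A i j = A j i) /\ forall v, 0 <= qform A v.
Proof.
have qE (v : 'cV[R]_n) : (v^T *m A *m v) 0 0 = qform A (fun i => v i 0).
  rewrite mxE /qform exchange_big; apply: eq_bigr => j _.
  by rewrite mxE mulr_suml; apply: eq_bigr => i _; rewrite mxE.
split=> [[symA A_ge0]|[symA A_ge0]]; split.
- move=> i j; move: symA; rewrite is_hermitianmxE expr0 scale1r => /eqP {1}->.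
  by rewrite !mxE.
- move=> v; rewrite (_ : qform A v = qform A (fun i => (\col_k v k) i 0)).
    by rewrite -qE.
  by apply: eq_bigr => i _; apply: eq_bigr => j _; rewrite !mxE.
- rewrite is_hermitianmxE expr0 scale1r; apply/eqP/matrixP => i j.
  by rewrite !mxE symA.
- by move=> v; rewrite qE.
Qed.

Lemma qformD A B v : qform (A + B) v = qform A v + qform B v.
Proof.
rewrite /qform -big_split; apply: eq_bigr => i _; rewrite -big_split.
by apply: eq_bigr => j _; rewrite mxE mulrDr mulrDl.
Qed.

Lemma qformZ c A v : qform (c *: A) v = c * qform A v.
Proof.
rewrite /qform mulr_sumr; apply: eq_bigr => i _; rewrite mulr_sumr.
by apply: eq_bigr => j _; rewrite mxE; ring.
Qed.

Lemma psdmx0 : psdmx (0 : 'M[R]_n).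
Proof.
apply/psdmxP; split=> [i j|v]; first by rewrite !mxE.
rewrite /qform big1 // => i _; rewrite big1 // => j _.
by rewrite mxE mulr0 mul0r.
Qed.

Lemma psdmxD A B : psdmx A -> psdmx B -> psdmx (A + B).
Proof.
move=> /psdmxP[sA pA] /psdmxP[sB pB]; apply/psdmxP; split=> [i j|v].
  by rewrite !mxE sA sB.
by rewrite qformD addr_ge0.
Qed.

Lemma psdmxZ c A : 0 <= c -> psdmx A -> psdmx (c *: A).
Proof.
move=> c0 /psdmxP[sA pA]; apply/psdmxP; split=> [i j|v].
  by rewrite !mxE sA.
by rewrite qformZ mulr_ge0.
Qed.

Lemma psdmx1 : psdmx (1%:M : 'M[R]_n).
Proof.
apply/psdmxP; split=> [i j|v]; first by rewrite !mxE eq_sym.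
apply: sumr_ge0 => i _; rewrite (bigD1 i) //= big1 => [|j ji].
  by rewrite mxE eqxx mulr1 addr0 -expr2 sqr_ge0.
by rewrite mxE eq_sym (negbTE ji) mulr0 mul0r.
Qed.

Lemma psdmx_const1 : psdmx (const_mx 1 : 'M[R]_n).
Proof.
apply/psdmxP; split=> [i j|v]; first by rewrite !mxE.
suff -> : qform (const_mx 1) v = (\sum_i v i) ^+ 2 by exact: sqr_ge0.
rewrite /qform expr2 mulr_suml; apply: eq_bigr => i _.
by rewrite mulr_sumr; apply: eq_bigr => j _; rewrite mxE mulr1.
Qed.

(** Perturbing the argument along one coordinate gives a quadratic polynomial
    in the perturbation: two perturbations of [v = 0] yield the inequality of
    the two by two minors, and the minimum over [t] yields the Schur
    complement. *)
Lemma qform_addZ_delta A v k t : (forall i j, A i j = A j i) ->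
  qform A (fun i => v i + t * (i == k)%:R) =
  qform A v + 2 * t * (\sum_j A k j * v j) + t ^+ 2 * A k k.
Proof.
move=> sA.
have pick (F : 'I_n -> R) : \sum_j F j * (j == k)%:R = F k.
  rewrite (bigD1 k) //= big1 ?eqxx ?mulr1 ?addr0 // => j /negbTE ->.
  by rewrite mulr0.
have -> : qform A (fun i => v i + t * (i == k)%:R) =
    \sum_i (\sum_j v i * A i j * v j + t * (v i * A i k)
      + t * ((\sum_j A i j * v j) * (i == k)%:R)
      + t ^+ 2 * (A i k * (i == k)%:R)).
  apply: eq_bigr => i _.
  rewrite -[A i k in RHS](pick (A i)) mulr_sumr mulr_sumr mulr_suml mulr_sumr.
  rewrite mulr_suml mulr_sumr -!big_split; apply: eq_bigr => j _ /=.
  ring.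
rewrite !big_split /= -!mulr_sumr !pick.
have -> : \sum_i v i * A i k = \sum_j A k j * v j.
  by apply: eq_bigr => i _; rewrite mulrC sA.
rewrite -/(qform A v); ring.
Qed.

Lemma psdmx_minor2_ge0 A i j a b : psdmx A ->
  0 <= a ^+ 2 * A i i + 2 * a * b * A i j + b ^+ 2 * A j j.
Proof.
move=> /psdmxP[sA pA]; set w := fun k : 'I_n => 0 + b * (k == j)%:R.
have := pA (fun k => w k + a * (k == i)%:R).
rewrite qform_addZ_delta // /w qform_addZ_delta //.
have -> : qform A (fun=> 0) = 0.
  by rewrite /qform big1 // => k _; rewrite big1 // => l _; rewrite mulr0.
rewrite [\sum_k A j k * 0]big1 => [|k _]; last by rewrite mulr0.
rewrite (bigD1 j) //= big1 => [|k /negbTE ->]; last by rewrite mulr0 addr0 mulr0.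
rewrite eqxx /= => /le_trans; apply; rewrite le_eqVlt; apply/orP; left.
by apply/eqP; ring.
Qed.

Lemma psdmx_diag_ge0 A i : psdmx A -> 0 <= A i i.
Proof. by move=> /(psdmx_minor2_ge0 i i 1 0); lra. Qed.

(** In [0 <= 2 a A_ij + A_jj] the number [a] is arbitrary, which forces
    [A_ij = 0]. *)
Lemma psdmx_diag0 A i j : psdmx A -> A i i = 0 -> A i j = 0.
Proof.
move=> psdA Aii; apply/eqP; apply: contraT => Aij.
(* This weight makes the form equal to -1. *)
have := psdmx_minor2_ge0 i j (- (A j j + 1) / (2 * A i j)) 1 psdA.
rewrite Aii mulr0 add0r expr1n.
have -> : 2 * (- (A j j + 1) / (2 * A i j)) * 1 * A i j = - (A j j + 1).
  by field.
lra.
Qed.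

Lemma psdmx_entry_bound A i j : psdmx A -> A i i = 1 -> A j j = 1 ->
  -1 <= A i j <= 1.
Proof.
move=> psdA Aii Ajj.
have := psdmx_minor2_ge0 i j 1 1 psdA; have := psdmx_minor2_ge0 i j 1 (-1) psdA.
rewrite Aii Ajj; lra.
Qed.

(** The new form at [v] is the old one at the point of the line [v + t e_k]
    where it is minimal, so it remains nonnegative. *)
Lemma psdmx_schur_complement A k : psdmx A -> A k k != 0 ->
  psdmx (\matrix_(i, j) (A i j - A i k * A k j / A k k)).
Proof.
move=> /psdmxP[sA pA] Akk; apply/psdmxP; split=> [i j|v].
  by rewrite !mxE (sA i j) (sA i k) (sA k j) [A k i * _]mulrC.
set s := \sum_j A k j * v j.
suff -> : qform (\matrix_(i, j) (A i j - A i k * A k j / A k k)) v =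
    qform A (fun i => v i + (- s / A k k) * (i == k)%:R) by exact: pA.
rewrite qform_addZ_delta // -/s -addrA.
have -> : 2 * (- s / A k k) * s + (- s / A k k) ^+ 2 * A k k =
    \sum_i \sum_j - (A k i * v i) * (A k j * v j) / A k k.
  transitivity (- (s * s / A k k)); first by field.
  rewrite {1}/s !mulr_suml -sumrN; apply: eq_bigr => i _.
  rewrite /s mulr_sumr mulr_suml -sumrN; apply: eq_bigr => j _; ring.
rewrite /qform -big_split; apply: eq_bigr => i _.
rewrite -big_split; apply: eq_bigr => j _; rewrite mxE (sA i k) /=; ring.
Qed.

(** Subtracting from [A] the rank one matrix given by its [k]-th row leaves a
    positive semidefinite matrix with one more zero on the diagonal; induction on
    the number of nonzero diagonal entries thus writes [A] as a sum of
    matrices [w w^T], for which the product with [B] is the form of [B]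
    with rescaled argument. *)
Theorem schur_product A B :
  psdmx A -> psdmx B -> psdmx (map2_mx *%R A B).
Proof.
move=> psdA psdB; have [m] := ubnP #|[set i | A i i != 0]|%SET.
elim: m A psdA => // m IH A psdA card_lt.
have [k Akk|/(_ _)/eqP A0] := pickP (fun k => A k k != 0); last first.
  suff -> : map2_mx *%R A B = 0 by exact: psdmx0.
  by apply/matrixP => i j; rewrite !mxE (psdmx_diag0 _ psdA) ?mul0r // A0.
set A' := \matrix_(i, j) (A i j - A i k * A k j / A k k).
have sA i j : A i j = A j i by have /psdmxP[] := psdA.
have -> : map2_mx *%R A B =
    map2_mx *%R A' B + \matrix_(i, j) (A k i * B i j * A k j / A k k).
  by apply/matrixP => i j; rewrite !mxE (sA k i); ring.
apply: psdmxD; first apply: IH; first exact: psdmx_schur_complement.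
- rewrite -ltnS; apply: leq_trans card_lt; rewrite ltnS; apply: proper_card.
  apply/properP; split.
    apply/fintype.subsetP => i; rewrite !inE mxE; apply: contra => /eqP Aii.
    by rewrite (psdmx_diag0 k psdA Aii) Aii !mul0r subrr.
  by exists k; rewrite !inE // mxE mulfK // subrr eqxx.
- have /psdmxP[sB pB] := psdB; apply/psdmxP; split=> [i j|v].
    by rewrite !mxE sB; ring.
  rewrite (_ : qform _ v = (A k k)^-1 * qform B (fun i => A k i * v i)).
    by rewrite mulr_ge0 // invr_ge0 psdmx_diag_ge0.
  rewrite /qform mulr_sumr; apply: eq_bigr => i _; rewrite mulr_sumr.
  by apply: eq_bigr => j _; rewrite mxE; ring.
Qed.

Lemma psdmx_map_exp A k : psdmx A -> psdmx (map_mx (fun x => x ^+ k) A).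
Proof.
move=> psdA; elim: k => [|k IH].
  suff -> : map_mx (fun x => x ^+ 0) A = const_mx 1 by exact: psdmx_const1.
  by apply/matrixP => i j; rewrite !mxE.
suff -> : map_mx (fun x => x ^+ k.+1) A =
    map2_mx *%R A (map_mx (fun x => x ^+ k) A) by exact: schur_product.
by apply/matrixP => i j; rewrite !mxE exprS.
Qed.

Lemma psdmx_cvg (T : Type) (F : set_system T) (FF : ProperFilter F)
  (As : T -> 'M[R]_n) A : (\forall t \near F, psdmx (As t)) ->
  (forall i j, As t i j @[t --> F] --> A i j) -> psdmx A.
Proof.
move=> psdAs cvgAs; apply/psdmxP; split=> [i j|v].
  apply: cvg_unique (cvgAs i j) _ => //.
  apply: cvg_trans (cvgAs j i); apply: near_eq_cvg.
  by apply: filterS psdAs => t /psdmxP[].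
have qcvg : qform (As t) v @[t --> F] --> qform A v.
  apply: cvg_big => [|i _]; first exact: add_continuous.
  apply: cvg_big => [|j _]; first exact: add_continuous.
  by apply: cvgM; [apply: cvgM => //; exact: cvg_cst|exact: cvg_cst].
rewrite -(cvg_lim (@Rhausdorff R) qcvg); apply: limr_ge.
  exact: cvgP qcvg.
by apply: filterS psdAs => t /psdmxP[].
Qed.

Lemma psdmx_map_pseries A c : psdmx A -> (forall k, 0 <= c k) ->
  (forall i j, cvgn (pseries c (A i j))) ->
  psdmx (map_mx (fun x => limn (pseries c x)) A).
Proof.
move=> psdA c_ge0 cvgA.
pose As N : 'M[R]_n := map_mx (fun x => pseries c x N) A.
apply: (@psdmx_cvg _ \oo _ As) => [|i j]; last first.
  by rewrite mxE; under eq_fun do rewrite mxE; exact: cvgA.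
apply: nearW; elim=> [|N IH].
  suff -> : As 0%N = 0 by exact: psdmx0.
  by apply/matrixP => i j; rewrite !mxE /pseries /series /= big_geq.
suff -> : As N.+1 = As N + c N *: map_mx (fun x => x ^+ N) A.
  by apply: psdmxD => //; apply: psdmxZ => //; exact: psdmx_map_exp.
by apply/matrixP => i j; rewrite !mxE /pseries /series /= big_nat_recr.
Qed.

End Psd.

(** * Power series on the open unit disc *)

Section PowerSeries.
Variable R : realType.
Implicit Types (c : R^nat) (x : R).

(** The partial sums are dominated by the sum [(1 - `|x|)^-2], through the
    closed form of the arithmetico-geometric sum. *)
Lemma is_cvg_pseries_natS x : `|x| < 1 -> cvgn (pseries (fun k => k.+1%:R) x).
Proof.
move=> x1; apply: normed_cvg.
rewrite (_ : [normed _] = series (fun k => k.+1%:R * `|x| ^+ k)); last first.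
  by congr series; apply/funext => k; rewrite /= normrM normrX normr_nat.
have sumE m : (1 - `|x|) ^+ 2 * (\sum_(0 <= k < m) k.+1%:R * `|x| ^+ k) =
    1 - `|x| ^+ m - m%:R * (1 - `|x|) * `|x| ^+ m.
  elim: m => [|m IH]; first by rewrite big_geq // expr0; ring.
  by rewrite big_nat_recr //= mulrDr IH [_ ^+ m.+1]exprS -natr1; ring.
apply: nondecreasing_is_cvgn.
  by apply: nondecreasing_series => k _ _; rewrite mulr_ge0 // exprn_ge0.
exists ((1 - `|x|) ^- 2) => _ [m _ <-].
rewrite -[leRHS]mulr1 ler_pdivlMl ?exprn_gt0 ?subr_gt0 //.
rewrite /series /= sumE.
have : 0 <= `|x| ^+ m by rewrite exprn_ge0.
have : 0 <= m%:R * (1 - `|x|) * `|x| ^+ m.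
  by rewrite !mulr_ge0 ?exprn_ge0 // subr_ge0 ltW.
lra.
Qed.

Lemma is_cvg_pseries_bounded c M x : (forall k, `|c k| <= M) -> `|x| < 1 ->
  cvgn (pseries c x).
Proof.
move=> cM x1; apply: normed_cvg.
have M0 : 0 <= M by apply: le_trans (cM 0%N).
apply: (@series_le_cvg _ _ (geometric M `|x|)) => [k|k|k|] //=.
- by rewrite mulr_ge0 ?exprn_ge0.
- by rewrite normrM normrX ler_wpM2r ?exprn_ge0.
- by apply: is_cvg_geometric_series; rewrite normr_id.
Qed.

(** The terms of the series at [K] are bounded, so those of the derived series
    at [x] are dominated by a multiple of [(k + 1) * `|x / K| ^+ k]. *)
Lemma is_cvg_pseries_diffs c K x : cvgn (pseries c K) -> `|x| < `|K| ->
  cvgn (pseries (pseries_diffs c) x).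
Proof.
move=> cK xK.
have K0 : K != 0 by rewrite -normr_gt0 (le_lt_trans _ xK).
have [M [Mreal Mc]] := cvg_series_bounded cK.
have {}Mc k : `|c k * K ^+ k| <= `|M| + 1.
  by apply: Mc => //; rewrite (le_lt_trans (ler_norm M)) // ltrDl.
apply: normed_cvg.
apply: (@series_le_cvg _ _
    ((`|M| + 1) / `|K| *: (fun k => k.+1%:R * `|x / K| ^+ k))) => [k|k|k|] //=.
- by rewrite !mulr_ge0 ?exprn_ge0 ?invr_ge0 ?addr_ge0.
- rewrite /pseries_diffs.
  have -> : k.+1%:R * c k.+1 * x ^+ k =
      c k.+1 * K ^+ k.+1 / K * (k.+1%:R * (x / K) ^+ k).
    by rewrite exprS expr_div_n; field; rewrite K0 expf_neq0.
  rewrite normrM [leRHS]/(GRing.scale _ _) /= [X in _ * X <= _]normrM normr_nat.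
  rewrite normrX ler_wpM2r ?mulr_ge0 ?exprn_ge0 //.
  by rewrite normrM normfV ler_wpM2r ?invr_ge0.
- apply: is_cvg_seriesZ; apply: is_cvg_pseries_natS.
  by rewrite normr_id normrM normfV ltr_pdivrMr ?normr_gt0 // mul1r.
Qed.

Lemma is_cvg_pseries_diffs_unit_disc c x :
  (forall y, `|y| < 1 -> cvgn (pseries c y)) -> `|x| < 1 ->
  cvgn (pseries (pseries_diffs c) x).
Proof.
move=> cc x1; have [xm m1] := midf_lt x1.
have m0 : 0 <= (`|x| + 1) / 2 by rewrite divr_ge0 ?addr_ge0.
apply: (@is_cvg_pseries_diffs _ ((`|x| + 1) / 2)).
  by apply: cc; rewrite ger0_norm.
by rewrite [ltRHS]ger0_norm.
Qed.

Lemma is_derive_pseries_unit_disc c x :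
  (forall y, `|y| < 1 -> cvgn (pseries c y)) -> `|x| < 1 ->
  is_derive x (1 : R) (fun x => limn (pseries c x))
    (limn (pseries (pseries_diffs c) x)).
Proof.
move=> cc x1; have [xm m1] := midf_lt x1.
have m0 : 0 <= (`|x| + 1) / 2 by rewrite divr_ge0 ?addr_ge0.
have K1 : `|(`|x| + 1) / 2| < 1 by rewrite ger0_norm.
have cd : forall y, `|y| < 1 -> cvgn (pseries (pseries_diffs c) y).
  by move=> y; exact: is_cvg_pseries_diffs_unit_disc.
apply: (@pseries_snd_diffs _ _ ((`|x| + 1) / 2)).
- exact: cc.
- exact: cd.
- exact: is_cvg_pseries_diffs_unit_disc.
- by rewrite [ltRHS]ger0_norm.
Qed.

Lemma cvg_pseries_shift c x l :
  pseries (fun k => c k.+1) x @ \oo --> l ->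
  pseries c x @ \oo --> c 0%N + x * l.
Proof.
move=> cl; rewrite -cvg_shiftS /=.
rewrite (_ : (fun n => _) = fun n => c 0%N + x * pseries (fun k => c k.+1) x n).
  by apply: cvgD; [exact: cvg_cst|apply: cvgM; [exact: cvg_cst|]].
apply/funext => n; rewrite /pseries /series /= big_nat_recl //= expr0 mulr1.
by congr (_ + _); rewrite mulr_sumr; apply: eq_bigr => k _; rewrite exprS; ring.
Qed.

Lemma lim_pseries0 c : limn (pseries c 0) = c 0%N.
Proof.
apply: (@cvg_lim _ (@Rhausdorff R)); rewrite -cvg_shiftS /=.
rewrite (_ : (fun n => _) = fun=> c 0%N); first exact: cvg_cst.
apply/funext => n; rewrite /pseries /series /= big_nat_recl //= expr0 mulr1.
by rewrite big1 ?addr0 // => k _; rewrite expr0n mulr0.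
Qed.

End PowerSeries.

(** * The power series of sin (lambda * asin x) *)

Section SinMulAsin.
Variable R : realType.
Implicit Types (lambda x t : R).

(** The Taylor coefficients at [0] of [sin (lambda * asin x)], read off the
    differential equation [(1 - x^2) y'' = x y' - lambda^2 y]. *)
Fixpoint sin_mul_asin_coef lambda (k : nat) : R :=
  if k is j.+1 then
    if j is m.+1 then
      (m%:R ^+ 2 - lambda ^+ 2) / (m.+1%:R * m.+2%:R) * sin_mul_asin_coef lambda m
    else lambda
  else 0.

Local Notation a := sin_mul_asin_coef.
Local Notation S lambda x := (limn (pseries (a lambda) x)).
Local Notation S1 lambda x := (limn (pseries (pseries_diffs (a lambda)) x)).
Local Notation S2 lambda x :=
  (limn (pseries (pseries_diffs (pseries_diffs (a lambda))) x)).

Lemma sin_mul_asin_coefSS lambda k :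
  k.+2%:R * (k.+1%:R * a lambda k.+2) = (k%:R ^+ 2 - lambda ^+ 2) * a lambda k.
Proof. by rewrite /=; field; rewrite !gt_eqF ?ltr_wpDr. Qed.

(** The recurrence factor lies in [[0, 1]] except possibly at [k = 0], where it
    multiplies the vanishing constant coefficient. *)
Lemma sin_mul_asin_coef_bound lambda k : 0 <= lambda <= 1 ->
  0 <= a lambda k <= 1.
Proof.
move=> /andP[l0 l1]; have [m] := ubnP k.
elim: m k => // m IH [|[|k]] km; rewrite ?ler01 ?lexx ?l0 ?l1 //.
have {IH} /andP[ak0 ak1] : 0 <= a lambda k <= 1 by apply: IH; lia.
case: k km ak0 ak1 => [|k] _ ak0 ak1; first by rewrite /= mulr0 lexx ler01.
have k1 : 1 <= k.+1%:R :> R by rewrite ler1n.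
have c0 : 0 <= (k.+1%:R ^+ 2 - lambda ^+ 2) / (k.+2%:R * k.+3%:R) :> R.
  by rewrite divr_ge0 ?mulr_ge0 // subr_ge0 ler_sqr ?nnegrE // (le_trans l1).
have c1 : (k.+1%:R ^+ 2 - lambda ^+ 2) / (k.+2%:R * k.+3%:R) <= 1 :> R.
  rewrite ler_pdivrMr ?mulr_gt0 // mul1r -!(natr1 k.+2) -!(natr1 k.+1).
  have := sqr_ge0 lambda; nra.
by rewrite mulr_ge0 //= mulr_ile1.
Qed.

Lemma is_cvg_pseries_sin_mul_asin lambda x : 0 <= lambda <= 1 -> `|x| < 1 ->
  cvgn (pseries (a lambda) x).
Proof.
move=> l01; apply: (@is_cvg_pseries_bounded _ _ 1) => k.
by have /andP[a0 a1] := sin_mul_asin_coef_bound k l01; rewrite ger0_norm.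
Qed.

(** Termwise, [x y'] has coefficients [k a_k] and [x^2 y''] has coefficients
    [k (k - 1) a_k], so the recurrence says exactly that
    [y'' = x^2 y'' + x y' - lambda^2 y]. *)
Lemma sin_mul_asin_ode lambda x : 0 <= lambda <= 1 -> `|x| < 1 ->
  (1 - x ^+ 2) * S2 lambda x = x * S1 lambda x - lambda ^+ 2 * S lambda x.
Proof.
move=> l01 x1.
have c0 y : `|y| < 1 -> cvgn (pseries (a lambda) y).
  exact: is_cvg_pseries_sin_mul_asin.
have c1 y : `|y| < 1 -> cvgn (pseries (pseries_diffs (a lambda)) y).
  exact: is_cvg_pseries_diffs_unit_disc.
have c2 : cvgn (pseries (pseries_diffs (pseries_diffs (a lambda))) x).
  exact: is_cvg_pseries_diffs_unit_disc.
have theta1 : pseries (fun k => k%:R * a lambda k) x @ \oo --> x * S1 lambda x.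
  rewrite -[x * _]add0r -(mul0r (a lambda 0)).
  by apply: cvg_pseries_shift; exact: c1.
have theta2 : pseries (fun k => k%:R * (k.-1%:R * a lambda k)) x @ \oo -->
    x * (x * S2 lambda x).
  rewrite -[x * (_ * _)]add0r -(mul0r (0%:R * a lambda 0)).
  apply: cvg_pseries_shift.
  rewrite -[x * S2 _ _]add0r -(mulr0 1) -[X in 1 * X](mul0r (a lambda 1)).
  apply: (@cvg_pseries_shift _ (fun k => k.+1%:R * (k%:R * a lambda k.+1))).
  rewrite (_ : (fun k => _) = pseries_diffs (pseries_diffs (a lambda))) //.
  by apply/funext => k; rewrite /pseries_diffs; ring.
have sumE : pseries (pseries_diffs (pseries_diffs (a lambda))) x =
    pseries (fun k => k%:R * (k.-1%:R * a lambda k)) x +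
    pseries (fun k => k%:R * a lambda k) x -
    cst (lambda ^+ 2) * pseries (a lambda) x.
  apply/funext => m; rewrite /pseries /series /= !fctE /=.
  rewrite mulr_sumr -big_split -sumrB; apply: eq_bigr => k _ /=.
  transitivity ((k%:R ^+ 2 - lambda ^+ 2) * a lambda k * x ^+ k).
    by rewrite -sin_mul_asin_coefSS /pseries_diffs; ring.
  by case: k => [|k] /=; [ring|rewrite -natr1; ring].
have /cvg_lim : pseries (pseries_diffs (pseries_diffs (a lambda))) x @ \oo -->
    x * (x * S2 lambda x) + x * S1 lambda x - lambda ^+ 2 * S lambda x.
  rewrite [X in X @ _ --> _]sumE; apply: cvgB; first exact: cvgD.
  by apply: cvgM; [exact: cvg_cst|exact: c0].
move=> /(_ (@Rhausdorff R)) E.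
by rewrite mulrBl mul1r {1}E; ring.
Qed.

Lemma is_derive0_itv_cst (f : R -> R) (l r x y : R) :
  {in `]l, r[%R, forall z : R, is_derive z (1 : R) f 0} ->
  x \in `]l, r[%R -> y \in `]l, r[%R -> f x = f y.
Proof.
move=> df xI yI.
wlog xy : x y xI yI / x <= y.
  by move=> H; have [/H|/ltW/H] := leP x y => -> //.
have sub z : z \in `[x, y]%R -> is_derive z (1 : R) f 0.
  move: xI yI; rewrite !in_itv /= => /andP[lx _] /andP[_ yr] /andP[xz zy].
  by apply: df; rewrite in_itv /= (lt_le_trans lx) //= (le_lt_trans zy).
have df0 z : z \in `]x, y[%R -> is_derive z (1 : R) f ((fun=> 0 : R) z).
  by move=> zI; apply: sub; apply: subset_itv_oo_cc zI.
have fcont : {within `[x, y], continuous f}.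
  by apply: derivable_within_continuous => w /sub[].
have [z _] := MVT_segment xy df0 fcont.
by rewrite mul0r => /subr0_eq.
Qed.

(** With [h t] the series at [sin t], [s t = sin (lambda * t)] and
    [c t = cos (lambda * t)], the quantities [h' s - lambda h c] and
    [h' c + lambda h s] are constant on the interval where [`|sin t| < 1],
    because [h'' = - lambda^2 h].  Their values at [0] are [0] and [lambda];
    eliminating [h'] gives [lambda h = lambda s]. *)
Lemma sin_mul_asinE lambda x : 0 < lambda <= 1 -> `|x| < 1 ->
  sin (lambda * asin x) = S lambda x.
Proof.
move=> /andP[l0 l1] x1; have l01 : 0 <= lambda <= 1 by rewrite ltW.
pose F y : R := S lambda y; pose F1 y : R := S1 lambda y.
pose F2 y : R := S2 lambda y.
pose h t := F (sin t); pose dh t := F1 (sin t) * cos t.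
pose s t : R := sin (lambda * t); pose c t : R := cos (lambda * t).
have c0 y : `|y| < 1 -> cvgn (pseries (a lambda) y).
  exact: is_cvg_pseries_sin_mul_asin.
have dF y : `|y| < 1 -> is_derive y (1 : R) F (F1 y).
  exact: is_derive_pseries_unit_disc.
have dF1 y : `|y| < 1 -> is_derive y (1 : R) F1 (F2 y).
  apply: is_derive_pseries_unit_disc => z.
  exact: is_cvg_pseries_diffs_unit_disc.
have sin_lt1 t : t \in `](- (pi / 2)), (pi / 2)[%R -> `|sin t| < 1 :> R.
  move=> /[dup] tI; rewrite in_itv /= => /andP[t1 t2].
  have := cos_gt0_pihalf (introT andP (conj t1 t2)); have := cos2Dsin2 t.
  move=> cs ct; rewrite -(@ltr_sqr R) ?nnegrE // real_normK ?num_real // expr1n.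
  by rewrite -cs ltrDr exprn_gt0.
have dh_ t : t \in `](- (pi / 2)), (pi / 2)[%R -> is_derive t (1 : R) h (dh t).
  by move=> /sin_lt1 /dF dFt; exact: is_derive1_comp dFt (is_derive_sin t).
have ddh t : t \in `](- (pi / 2)), (pi / 2)[%R ->
    is_derive t (1 : R) dh (- lambda ^+ 2 * h t).
  move=> /sin_lt1 st.
  have D := is_deriveM (is_derive1_comp (dF1 _ st) (is_derive_sin t))
    (is_derive_cos t).
  apply: (is_derive_eq D).
  rewrite /GRing.scale /= /h.
  have := sin_mul_asin_ode l01 st; rewrite -/(F _) -/(F1 _) -/(F2 _).
  by rewrite -cos2sin2; lra.
have dl t : is_derive t (1 : R) ( *%R lambda) lambda.
  have D := is_deriveZ (f := id) lambda (is_derive_id t (1 : R)).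
  by apply: (is_derive_eq D); rewrite /GRing.scale /= mulr1.
have ds t : is_derive t (1 : R) s (c t * lambda).
  by apply: is_derive1_comp; exact: is_derive_sin.
have dc t : is_derive t (1 : R) c (- s t * lambda).
  by apply: is_derive1_comp; exact: is_derive_cos.
have I0 : (0 : R) \in `](- (pi / 2)), (pi / 2)[%R.
  by rewrite in_itv /= oppr_lt0 andbb divr_gt0 ?pi_gt0.
have h0 : h 0 = 0 by rewrite /h sin0 /F lim_pseries0.
have dh0 : dh 0 = lambda.
  by rewrite /dh sin0 cos0 mulr1 /F1 lim_pseries0 /pseries_diffs mul1r.
have s0 : s 0 = 0 by rewrite /s mulr0 sin0.
have c0' : c 0 = 1 by rewrite /c mulr0 cos0.
have E0 t : t \in `](- (pi / 2)), (pi / 2)[%R ->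
    dh t * s t - lambda * (h t * c t) = 0.
  move=> tI; pose B := dh * s - lambda *: (h * c).
  transitivity (B 0); last first.
    by rewrite /B !fctE /= h0 s0 mulr0 mul0r scaler0 subrr.
  apply: (@is_derive0_itv_cst B _ _ _ _ _ tI I0) => z zI.
  have D := is_deriveB (is_deriveM (ddh z zI) (ds z))
    (is_deriveZ lambda (is_deriveM (dh_ z zI) (dc z))).
  by apply: (is_derive_eq D); rewrite /GRing.scale /=; ring.
have E1 t : t \in `](- (pi / 2)), (pi / 2)[%R ->
    dh t * c t + lambda * (h t * s t) = lambda.
  move=> tI; pose B := dh * c + lambda *: (h * s).
  transitivity (B 0); last first.
    by rewrite /B !fctE /= h0 dh0 c0' mul0r scaler0 mulr1 addr0.
  apply: (@is_derive0_itv_cst B _ _ _ _ _ tI I0) => z zI.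
  have D := is_deriveD (is_deriveM (ddh z zI) (dc z))
    (is_deriveZ lambda (is_deriveM (dh_ z zI) (ds z))).
  by apply: (is_derive_eq D); rewrite /GRing.scale /=; ring.
have xI : -1 < x < 1 by rewrite -ltr_norml.
have tI : asin x \in `](- (pi / 2)), (pi / 2)[%R.
  move: xI => /andP[x1' x1''].
  by rewrite in_itv /= asin_gtNpi2 ?asin_ltpi2 // ?x1' ?x1'' ltW.
rewrite -/(F x); have -> : F x = h (asin x).
  by move: xI => /andP[? ?]; rewrite /h asinK // in_itv /= !ltW.
have := E0 _ tI; have := E1 _ tI; have := cos2Dsin2 (lambda * asin x).
rewrite -/(s (asin x)) -/(c (asin x)) => cs e1 e0.
apply: (mulfI (lt0r_neq0 l0)).
have := congr1 ( *%R (s (asin x))) e1.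
have := congr1 ( *%R (c (asin x))) e0.
have := congr1 ( *%R (lambda * h (asin x))) cs.
lra.
Qed.

End SinMulAsin.

(** * The entrywise map sin (lambda * asin x) preserves positivity *)

Section SinMulAsinPsd.
Variables (R : realType) (n : nat).

(** Continuity up to the endpoints is what allows entries equal to [1] or [-1];
    it holds for the inverse of a continuous function on a segment. *)
Lemma continuous_asin_itv : {within `[-1, 1], continuous (@asin R)}.
Proof.
have pi2 : - (pi / 2) <= pi / 2 :> R.
  by rewrite -subr_ge0 opprK addr_ge0 ?divr_ge0 ?pi_ge0.
have := @segment_can_le_continuous R _ _ sin asin pi2.
rewrite sinN sin_pihalf; apply; last exact: sinK.
by apply: continuous_subspaceT; exact: continuous_sin.
Qed.

Lemma near_left1_itv01 : \forall r \near (1 : R)^'-, 0 < r < 1.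
Proof.
near=> r; apply/andP; split; near: r; [exact: nbhs_left_gt|exact: nbhs_left_lt].
Unshelve. all: by end_near.
Qed.

Lemma cvg_asin_mull (x : R) : -1 <= x <= 1 ->
  asin (r * x) @[r --> 1^'-] --> asin x.
Proof.
move=> x1; have xI : `[-1, 1]%classic x by rewrite /= in_itv.
have mulx : r * x @[r --> (1 : R)^'-] --> x.
  apply: cvg_at_left_filter; rewrite -[X in _ --> X]mul1r.
  by apply: cvgM; [exact: cvg_id|exact: cvg_cst].
have asinx : asin @ within `[-1, 1] (nbhs x) --> asin x.
  by move/subspace_continuousP: continuous_asin_itv; exact.
move=> U /asinx aU.
have rxU : \forall r \near (1 : R)^'-,
    `[-1, 1]%classic (r * x) -> U (asin (r * x)).
  exact: mulx aU.
apply: filterS2 rxU near_left1_itv01 => r + /andP[r0 r1]; apply.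
rewrite /= in_itv /= -ler_norml normrM gtr0_norm //.
by rewrite mulr_ile1 ?ler_norml // ltW.
Qed.

Lemma psdmx_map_sin_mul_asin (A : 'M[R]_n) lambda : psdmx A ->
  (forall i, A i i = 1) -> 0 <= lambda <= 1 ->
  psdmx (map_mx (fun x => sin (lambda * asin x)) A).
Proof.
move=> psdA A1 l01; have /andP[l0 l1] := l01.
have A_le1 i j : -1 <= A i j <= 1 by apply: psdmx_entry_bound.
move: l0; rewrite le_eqVlt => /predU1P[<-|{}l0].
  suff -> : map_mx (fun x => sin (0 * asin x)) A = 0 by exact: psdmx0.
  by apply/matrixP => i j; rewrite !mxE mul0r sin0.
have approx r : 0 < r < 1 ->
    psdmx (map_mx (fun x => sin (lambda * asin x)) (r *: A)).
  move=> /andP[r0 r1].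
  have rA i j : `|(r *: A) i j| < 1.
    rewrite mxE normrM gtr0_norm // (le_lt_trans _ r1) //.
    by rewrite ler_piMr ?ler_norml // ltW.
  have -> : map_mx (fun x => sin (lambda * asin x)) (r *: A) =
      map_mx (fun x => limn (pseries (sin_mul_asin_coef lambda) x)) (r *: A).
    by apply/matrixP => i j; rewrite [LHS]mxE [RHS]mxE sin_mul_asinE ?l0.
  apply: psdmx_map_pseries.
  - by apply: psdmxZ => //; exact: ltW.
  - by move=> k; have /andP[] := sin_mul_asin_coef_bound k l01.
  - by move=> i j; exact: is_cvg_pseries_sin_mul_asin.
apply: (@psdmx_cvg _ _ _ (1 : R)^'- _
    (fun r => map_mx (fun x => sin (lambda * asin x)) (r *: A))).
  exact: filterS approx near_left1_itv01.
move=> i j; rewrite mxE; under eq_fun do rewrite !mxE.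
apply: continuous_cvg; first exact: continuous_sin.
by apply: cvgM; [exact: cvg_cst|exact: cvg_asin_mull].
Qed.

End SinMulAsinPsd.

Theorem theorem2p2 (R : realType) (n : nat) (hn : (1 <= n)%N)
  (X : 'M[R]_n) (hX : @TA R n X) (lambda : R) (hlambda : 0 <= lambda <= 1) :
  @TA R n (lambda *: X + (1 - lambda) *: 1%:M).
Proof.
case: hX => A [psdA A1] <-.
have [l0 l1] := andP hlambda.
have pi2_ge0 : 0 <= pi / 2 :> R by rewrite divr_ge0 ?pi_ge0.
have asin1 : asin 1 = pi / 2 :> R.
  rewrite -[X in asin X]sin_pihalf sinK // in_itv /= lexx andbT.
  by rewrite (le_trans _ pi2_ge0) // oppr_le0.
pose s := sin (lambda * (pi / 2)).
(* On the diagonal the map yields s <= 1, which the second term completes to 1. *)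
exists (map_mx (fun x => sin (lambda * asin x)) A + (1 - s) *: 1%:M).
  split=> [|i]; last first.
    by rewrite !mxE A1 asin1 eqxx mulr1 addrC subrK.
  apply: psdmxD; first exact: psdmx_map_sin_mul_asin.
  by apply: psdmxZ; [rewrite subr_ge0 sin_le1|exact: psdmx1].
apply/matrixP => i j; rewrite !mxE.
have pi0 : pi != 0 :> R by rewrite gt_eqF ?pi_gt0.
have [<-|_] := eqVneq i j.
  rewrite A1 asin1 !mulr1 -/s addrCA subrr addr0 /trig_f asin1.
  by move: (pi : R) pi0 => p p0; field.
rewrite !mulr0 !addr0 /trig_f sinK; first by ring.
have /andP[Am AM] := psdmx_entry_bound psdA (A1 i) (A1 j).
have : - (pi / 2) <= asin (A i j) by rewrite asin_geNpi2 ?Am.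
have : asin (A i j) <= pi / 2 by rewrite asin_lepi2 ?Am.
rewrite in_itv /=; nra.
Qed.
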